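(* Let $f\colon A\to B$ be a morphism in an elementary topos $\mathcal E$. Then for every generalized element $\langle a,s\rangle\colon W\to B\times PA$, $$W\Vdash a\in_B\exists_f(s)\quad\text{if, and only if,}\quad W\Vdash\exists y\,\big((a=_B fy)\wedge(y\in_A s)\big),$$ where $y$ is a variable of type $A$.
   Context: Topos notation. $\top\colon 1\to\Omega$ is the subobject classifier, $\top_W\colon W\to 1\to\Omega$. $PX$ is the power object of $X$ with membership morphism $\in_X\colon X\times PX\to\Omega$; each $g\colon X\times Y\to\Omega$ has a unique transpose $\hat g\colon Y\to PX$ with $\in_X\circ(1\times\hat g)=g$. For $\langle x,s\rangle\colon W\to X\times PX$ write $x\in_X s$ for $\in_X\circ\langle x,s\rangle\colon W\to\Omega$. The direct image $\exists_f\colon PA\to PB$ is the transpose of the classifying morphism of the image of $(f\times 1)m\colon U_A\to B\times PA$, where $m\colon U_A\rightarrowtail A\times PA$ is the subobject classified by $\in_A$. $=_B\colon B\times B\to\Omega$ is the classifying morphism of the diagonal of $B$, and $\wedge$ is the meet on $\Omega$. Forcing. For $\phi\colon Z\to\Omega$ and $a\colon W\to Z$, $W\Vdash\phi(a)$ means $\phi\circ a=\top_W$. For $\psi\colon Z\times Y\to\Omega$, $\exists y\,\psi\colon Z\to\Omega$ is the transpose $Z\to PY$ of $\psi$ followed by $\exists_Y\colon PY\to P1\cong\Omega$, the direct image along $Y\to 1$. Equivalently, $W\Vdash\exists y\,\psi(a,y)$ iff there are an epimorphism $p\colon V\twoheadrightarrow W$ and $b\colon V\to Y$ with $V\Vdash\psi(ap,b)$.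 *)

(* Defs.v *)
Set Implicit Arguments.
Unset Strict Implicit.
Unset Printing Implicit Defensive.

Declare Scope topos_scope.
Delimit Scope topos_scope with topos.
Local Open Scope topos_scope.

Record category := Category {
  ob :> Type;
  hom : ob -> ob -> Type;
  idm : forall X : ob, hom X X;
  comp : forall X Y Z : ob, hom Y Z -> hom X Y -> hom X Z;
  comp_id_l : forall (X Y : ob) (f : hom X Y), comp (idm Y) f = f;
  comp_id_r : forall (X Y : ob) (f : hom X Y), comp f (idm X) = f;
  comp_assoc : forall (X Y Z T : ob)
      (h : hom Z T) (g : hom Y Z) (f : hom X Y),
    comp h (comp g f) = comp (comp h g) f
}.

Arguments hom {c} _ _.
Arguments idm {c} X.
Arguments comp {c X Y Z} _ _.

Notation "g ∘ f" := (comp g f) (at level 40, left associativity) : topos_scope.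

Definition monic (C : category) (X Y : C) (m : hom X Y) : Prop :=
  forall (W : C) (u v : hom W X), m ∘ u = m ∘ v -> u = v.

Definition is_pullback (C : category) (P X Y Z : C)
    (p : hom P X) (q : hom P Y) (f : hom X Z) (g : hom Y Z) : Prop :=
  f ∘ p = g ∘ q /\
  forall (W : C) (x : hom W X) (y : hom W Y), f ∘ x = g ∘ y ->
    exists! u : hom W P, p ∘ u = x /\ q ∘ u = y.

Record image_of (C : category) (X Y : C) (f : hom X Y) := ImageOf {
  im_ob : C;
  im_mor : hom im_ob Y;
  im_monic : monic im_mor;
  im_factor : exists e : hom X im_ob, im_mor ∘ e = f;
  im_least : forall (J : C) (n : hom J Y), monic n ->
    (exists e : hom X J, n ∘ e = f) -> exists k : hom im_ob J, n ∘ k = im_mor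
}.

Arguments im_monic {C X Y f} i W u v _.

(* Terminal object, binary products and equalizers yield all finite limits. *)
Record finite_limits (C : category) := FiniteLimits {
  one : C;
  bang : forall X : C, hom X one;
  bang_unique : forall (X : C) (u : hom X one), u = bang X;

  product : C -> C -> C;
  pr1 : forall X Y : C, hom (product X Y) X;
  pr2 : forall X Y : C, hom (product X Y) Y;
  pairing : forall W X Y : C, hom W X -> hom W Y -> hom W (product X Y);
  pr1_pairing : forall (W X Y : C) (x : hom W X) (y : hom W Y),
    pr1 X Y ∘ pairing x y = x;
  pr2_pairing : forall (W X Y : C) (x : hom W X) (y : hom W Y),
    pr2 X Y ∘ pairing x y = y;
  pairing_unique : forall (W X Y : C) (u : hom W (product X Y)),
    u = pairing (pr1 X Y ∘ u) (pr2 X Y ∘ u);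

  eqz : forall X Y : C, hom X Y -> hom X Y -> C;
  eqz_mor : forall (X Y : C) (f g : hom X Y), hom (eqz f g) X;
  eqz_eq : forall (X Y : C) (f g : hom X Y),
    f ∘ eqz_mor f g = g ∘ eqz_mor f g;
  eqz_univ : forall (X Y : C) (f g : hom X Y) (W : C) (h : hom W X),
    f ∘ h = g ∘ h -> exists! u : hom W (eqz f g), eqz_mor f g ∘ u = h
}.

Record subobject_classifier (C : category) (L : finite_limits C) := Classifier {
  omega : C;
  truth : hom (one L) omega;
  chi : forall (S X : C) (m : hom S X), monic m -> hom X omega;
  chi_pullback : forall (S X : C) (m : hom S X) (Hm : monic m),
    is_pullback m (bang L S) (chi Hm) truth;
  chi_unique : forall (S X : C) (m : hom S X) (Hm : monic m) (k : hom X omega),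
    is_pullback m (bang L S) k truth -> k = chi Hm
}.

Record power_objects (C : category) (L : finite_limits C)
    (O : subobject_classifier L) := PowerObjects {
  pow : C -> C;
  mem : forall X : C, hom (product L X (pow X)) (omega O);
  transp : forall X Y : C, hom (product L X Y) (omega O) -> hom Y (pow X);
  transp_spec : forall (X Y : C) (g : hom (product L X Y) (omega O)),
    mem X ∘ pairing L (pr1 L X Y) (transp g ∘ pr2 L X Y) = g;
  transp_unique : forall (X Y : C) (g : hom (product L X Y) (omega O))
      (h : hom Y (pow X)),
    mem X ∘ pairing L (pr1 L X Y) (h ∘ pr2 L X Y) = g -> h = transp g
}.

(* Power-object presentation of an elementary topos, with chosen structure;
   cartesian closure is then derivable, so exponentials are not a field. *)
Record topos := Topos {
  topos_cat :> category;
  topos_lim : finite_limits topos_cat;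
  topos_cls : subobject_classifier topos_lim;
  topos_pow : power_objects topos_cls
}.

Notation "𝟙" := (one (topos_lim _)) : topos_scope.
Notation "X × Y" := (product (topos_lim _) X Y)
  (at level 39, left associativity) : topos_scope.
Notation "⟨ x , y ⟩" := (pairing (topos_lim _) x y) : topos_scope.
Notation "'π₁'" := (pr1 (topos_lim _) _ _) : topos_scope.
Notation "'π₂'" := (pr2 (topos_lim _) _ _) : topos_scope.
Notation "'Ω'" := (omega (topos_cls _)) : topos_scope.
Notation "'𝒫' X" := (pow (topos_pow _) X)
  (at level 10, X at next level) : topos_scope.

Section ToposLemmas.

Variable E : topos.

Definition to_one (X : E) : hom X 𝟙 := bang (topos_lim E) X.

Definition top (W : E) : hom W Ω := truth (topos_cls E) ∘ to_one W.

Lemma to_one_eq (X : E) (u v : hom X 𝟙) : u = v.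
Proof. rewrite (bang_unique u); symmetry; apply bang_unique. Qed.

Lemma top_comp (V W : E) (p : hom V W) : top W ∘ p = top V.
Proof.
  unfold top; rewrite <- comp_assoc.
  now rewrite (to_one_eq (to_one W ∘ p) (to_one V)).
Qed.

Lemma pairing_eq (W X Y : E) (u v : hom W (X × Y)) :
  π₁ ∘ u = π₁ ∘ v -> π₂ ∘ u = π₂ ∘ v -> u = v.
Proof.
  intros H1 H2; rewrite (pairing_unique u), (pairing_unique v); now rewrite H1, H2.
Qed.

Lemma pairing_comp (V W X Y : E) (x : hom W X) (y : hom W Y) (p : hom V W) :
  ⟨ x, y ⟩ ∘ p = ⟨ x ∘ p, y ∘ p ⟩.
Proof.
  apply pairing_eq; rewrite comp_assoc.
  - now rewrite !pr1_pairing.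
  - now rewrite !pr2_pairing.
Qed.

Lemma from_one_monic (X : E) (u : hom 𝟙 X) : monic u.
Proof. intros W v w _; apply to_one_eq. Qed.

Lemma diag_monic (X : E) : monic ⟨ idm X, idm X ⟩.
Proof.
  intros W u v H.
  rewrite !pairing_comp, !comp_id_l in H.
  now rewrite <- (pr1_pairing (topos_lim E) u u), H, pr1_pairing.
Qed.

Lemma eqz_monic (X Y : E) (f g : hom X Y) : monic (eqz_mor (topos_lim E) f g).
Proof.
  intros W u v H.
  set (m := eqz_mor (topos_lim E) f g) in *.
  assert (Hv : f ∘ (m ∘ v) = g ∘ (m ∘ v)).
  { rewrite !comp_assoc; unfold m; now rewrite eqz_eq. }
  destruct (eqz_univ (topos_lim E) Hv) as [w [_ Hw]].
  now rewrite <- (Hw u H), <- (Hw v eq_refl).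
Qed.

Definition mem_at (W X : E) (x : hom W X) (s : hom W (𝒫 X)) : hom W Ω :=
  mem (topos_pow E) X ∘ ⟨ x, s ⟩.

Definition transpose (X Y : E) (g : hom (X × Y) Ω) : hom Y (𝒫 X) :=
  transp (topos_pow E) g.

Lemma mem_at_comp (V W X : E) (x : hom W X) (s : hom W (𝒫 X)) (p : hom V W) :
  mem_at x s ∘ p = mem_at (x ∘ p) (s ∘ p).
Proof. unfold mem_at; now rewrite <- comp_assoc, pairing_comp. Qed.

Lemma mem_at_transpose (W X Y : E) (g : hom (X × Y) Ω)
    (x : hom W X) (y : hom W Y) :
  mem_at x (transpose g ∘ y) = g ∘ ⟨ x, y ⟩.
Proof.
  transitivity (mem (topos_pow E) X ∘ ⟨ π₁, transpose g ∘ π₂ ⟩ ∘ ⟨ x, y ⟩).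
  - unfold mem_at; rewrite <- comp_assoc, pairing_comp, pr1_pairing.
    now rewrite <- comp_assoc, pr2_pairing.
  - unfold transpose; now rewrite transp_spec.
Qed.

Lemma pow_ext (X Y : E) (s t : hom Y (𝒫 X)) :
  mem_at π₁ (s ∘ π₂) = mem_at π₁ (t ∘ π₂) -> s = t.
Proof.
  intros H; transitivity (transpose (mem_at (@pr1 _ _ X Y) (t ∘ π₂))).
  - apply transp_unique; exact H.
  - symmetry; apply transp_unique; reflexivity.
Qed.

Definition sub_ob (X : E) (k : hom X Ω) : E := eqz (topos_lim E) k (top X).

Definition sub_mor (X : E) (k : hom X Ω) : hom (sub_ob k) X :=
  eqz_mor (topos_lim E) k (top X).

Lemma sub_classified (X : E) (k : hom X Ω) :
  is_pullback (sub_mor k) (to_one (sub_ob k)) k (truth (topos_cls E)).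
Proof.
  split.
  - unfold sub_mor, sub_ob; rewrite eqz_eq, top_comp; reflexivity.
  - intros W x y H.
    assert (Hx : k ∘ x = top X ∘ x).
    { now rewrite H, top_comp, (to_one_eq y (to_one W)). }
    destruct (eqz_univ (topos_lim E) Hx) as [u [Hu Huniq]].
    exists u; split.
    + split; [exact Hu | apply to_one_eq].
    + intros v [Hv _]; apply Huniq; exact Hv.
Qed.

Lemma chi_top (S X W : E) (m : hom S X) (Hm : monic m) (x : hom W X) :
  chi (topos_cls E) Hm ∘ x = top W <-> exists u : hom W S, m ∘ u = x.
Proof.
  destruct (chi_pullback (topos_cls E) Hm) as [Hc Hu]; split.
  - intros H; destruct (Hu W x (to_one W) H) as [u [[H1 _] _]].
    now exists u.
  - intros [u <-]; rewrite comp_assoc, Hc, <- comp_assoc.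
    unfold top; now rewrite (to_one_eq (_ ∘ u) (to_one W)).
Qed.

(* Internally, the image of f : X -> Y is { y | forall T in E_f, y in T } with
   E_f = { T in PY | forall x, f x in T }; both comprehensions are equalizers. *)
Section Image.

Variables (X Y : E) (f : hom X Y).

Definition img_inv : hom (𝒫 Y) (𝒫 X) := transpose (mem_at (f ∘ π₁) π₂).
Definition img_full : hom (𝒫 Y) (𝒫 X) := transpose (top (X × 𝒫 Y)).
Definition img_above : E := eqz (topos_lim E) img_inv img_full.
Definition img_above_mor : hom img_above (𝒫 Y) :=
  eqz_mor (topos_lim E) img_inv img_full.
Definition img_rel : hom Y (𝒫 img_above) :=
  transpose (mem_at π₂ (img_above_mor ∘ π₁)).
Definition img_all : hom Y (𝒫 img_above) := transpose (top (img_above × Y)).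
Definition img_ob : E := eqz (topos_lim E) img_rel img_all.
Definition img_mor : hom img_ob Y := eqz_mor (topos_lim E) img_rel img_all.

Lemma img_above_mem (W : E) (x : hom W X) (t : hom W img_above) :
  mem_at (f ∘ x) (img_above_mor ∘ t) = top W.
Proof.
  transitivity (mem_at x (img_inv ∘ (img_above_mor ∘ t))).
  - unfold img_inv; rewrite mem_at_transpose, mem_at_comp.
    now rewrite <- comp_assoc, pr1_pairing, pr2_pairing.
  - rewrite comp_assoc; unfold img_above_mor, img_above; rewrite eqz_eq.
    rewrite <- comp_assoc; unfold img_full.
    now rewrite mem_at_transpose, top_comp.
Qed.

Lemma img_factor : exists e : hom X img_ob, img_mor ∘ e = f.
Proof.
  assert (H : img_rel ∘ f = img_all ∘ f).
  { apply pow_ext; rewrite <- !comp_assoc; unfold img_rel, img_all.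
    rewrite !mem_at_transpose, mem_at_comp, top_comp.
    rewrite <- comp_assoc, pr1_pairing, pr2_pairing; apply img_above_mem. }
  destruct (eqz_univ (topos_lim E) H) as [e [He _]]; now exists e.
Qed.

Lemma img_least (J : E) (n : hom J Y) (Hn : monic n) :
  (exists e : hom X J, n ∘ e = f) -> exists k : hom img_ob J, n ∘ k = img_mor.
Proof.
  intros [e He].
  apply (proj1 (chi_top Hn img_mor)).
  set (c := chi (topos_cls E) Hn).
  set (t := transpose (c ∘ @pr1 _ (topos_lim E) Y 𝟙)).
  assert (Ht : img_inv ∘ t = img_full ∘ t).
  { apply pow_ext; rewrite <- !comp_assoc; unfold img_inv, img_full.
    rewrite !mem_at_transpose, mem_at_comp, top_comp.
    rewrite <- comp_assoc, pr1_pairing, pr2_pairing.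
    unfold t; rewrite mem_at_transpose, <- comp_assoc, pr1_pairing.
    unfold c; apply (proj2 (chi_top Hn _)).
    exists (e ∘ π₁); now rewrite comp_assoc, He. }
  destruct (eqz_univ (topos_lim E) Ht) as [u [Hu _]]; fold img_above in u.
  fold img_above_mor in Hu.
  transitivity (mem_at img_mor (t ∘ to_one img_ob)).
  { unfold t; now rewrite mem_at_transpose, <- comp_assoc, pr1_pairing. }
  rewrite <- Hu, <- comp_assoc.
  transitivity (mem_at (u ∘ to_one img_ob) (img_rel ∘ img_mor)).
  { unfold img_rel; rewrite mem_at_transpose, mem_at_comp.
    now rewrite <- comp_assoc, pr1_pairing, pr2_pairing. }
  unfold img_mor, img_ob; rewrite eqz_eq; unfold img_all.
  now rewrite mem_at_transpose, top_comp.
Qed.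

Definition image : image_of f :=
  ImageOf (@eqz_monic Y (𝒫 img_above) img_rel img_all) img_factor img_least.

End Image.

Definition direct_image (A B : E) (f : hom A B) : hom (𝒫 A) (𝒫 B) :=
  let m := sub_mor (mem (topos_pow E) A) in
  transpose (chi (topos_cls E) (im_monic (image (⟨ f ∘ π₁, π₂ ⟩ ∘ m)))).

Definition equal (B : E) : hom (B × B) Ω :=
  chi (topos_cls E) (@diag_monic B).

Definition meet : hom (Ω × Ω) Ω :=
  chi (topos_cls E)
    (@from_one_monic (Ω × Ω) ⟨ truth (topos_cls E), truth (topos_cls E) ⟩).

Definition equal_at (W B : E) (x y : hom W B) : hom W Ω := equal B ∘ ⟨ x, y ⟩.

Definition meet_at (W : E) (u v : hom W Ω) : hom W Ω := meet ∘ ⟨ u, v ⟩.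

Definition pow_one : hom (𝒫 𝟙) Ω := mem_at (to_one (𝒫 𝟙)) (idm (𝒫 𝟙)).

Lemma pow_one_iso :
  let i : hom Ω (𝒫 𝟙) := transpose (@pr2 _ (topos_lim E) 𝟙 Ω) in
  pow_one ∘ i = idm Ω /\ i ∘ pow_one = idm (𝒫 𝟙).
Proof.
  intros i; split.
  - unfold pow_one; rewrite mem_at_comp, comp_id_l.
    rewrite <- (comp_id_r i); unfold i.
    now rewrite mem_at_transpose, pr2_pairing.
  - apply pow_ext; rewrite <- comp_assoc; unfold i.
    rewrite mem_at_transpose, pr2_pairing; unfold pow_one.
    rewrite mem_at_comp.
    now rewrite (to_one_eq (to_one (𝒫 𝟙) ∘ π₂) π₁).
Qed.

(* The transpose Z -> PY is taken in the variable of type Y, which is the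
   second factor of Z × Y whereas [transpose] acts on the first one. *)
Definition exists_var (Z Y : E) (psi : hom (Z × Y) Ω) : hom Z Ω :=
  pow_one ∘ (direct_image (to_one Y) ∘ transpose (psi ∘ ⟨ π₂, π₁ ⟩)).

Definition forces (W Z : E) (phi : hom Z Ω) (a : hom W Z) : Prop :=
  phi ∘ a = top W.

End ToposLemmas.

Arguments top {E} W.
Arguments equal {E} B.
Arguments meet {E}.

Notation "x ∈ s" := (mem_at x s) (at level 70) : topos_scope.
Notation "x =Ω y" := (equal_at x y) (at level 70) : topos_scope.
Notation "u ∧ v" := (meet_at u v) (at level 80, right associativity) : topos_scope.

(* Main.v *)
(* The image used to define the direct image is the intersection of all subobjects
   through which the morphism factors, taken internally. So [b ∈ ∃_f(s)] holds at W
   iff, at every later stage, every T with [⟨f x, u⟩ ∈ T] whenever [x ∈ u] satisfies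
   [⟨b, s⟩ ∈ T]. Both sides of the equivalence have this form: the left one for f, at
   (a, s), the right one for A -> 1, at (!, D), where ! : W -> 1 and
   D = { y | a = f y ∧ y ∈ s }.
   A test family T for the right-hand side is pulled back along
   (b, u) |-> { y | b = f y ∧ y ∈ u }; a test family T for the left-hand side is sent
   to { v | v = D => ⟨a, s⟩ ∈ T }. No stability of epimorphisms is needed. *)
From Stdlib Require Import Setoid.
Require Import Defs.

Local Open Scope topos_scope.

Section GeneralizedElements.

Variable E : topos.

Lemma top_along (V W : E) (u : hom W Ω) (p : hom V W) :
  u = top W -> u ∘ p = top V.
Proof. intros ->; apply top_comp. Qed.

(** The hypothesis makes [k] and [l] true on the same generalized elements, so [sub_mor k] is a
    pullback of truth along either; classifying morphisms are unique. *)
Lemma omega_ext (X : E) (k l : hom X Ω) :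
  (forall (W : E) (x : hom W X), k ∘ x = top W <-> l ∘ x = top W) -> k = l.
Proof.
  intros H.
  set (Hm := eqz_monic (f := k) (g := top X) : monic (sub_mor k)).
  destruct (sub_classified k) as [Hk Hpb].
  assert (Htop : k ∘ sub_mor k = top (sub_ob k)) by exact Hk.
  transitivity (chi (topos_cls E) Hm).
  - apply chi_unique; exact (sub_classified k).
  - symmetry; apply chi_unique; split.
    + exact (proj1 (H _ _) Htop).
    + intros W x y Hx; apply Hpb.
      rewrite (to_one_eq y (to_one W)) in Hx |- *.
      exact (proj2 (H _ _) Hx).
Qed.

Lemma pow_ext_forced (W X : E) (s t : hom W (𝒫 X)) :
  (forall (V : E) (p : hom V W) (x : hom V X),
    (x ∈ s ∘ p) = top V <-> (x ∈ t ∘ p) = top V) -> s = t.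
Proof.
  intros H; apply pow_ext, omega_ext; intros V x.
  rewrite !mem_at_comp, <- !comp_assoc; apply H.
Qed.

Lemma equal_at_top (W B : E) (x y : hom W B) : (x =Ω y) = top W <-> x = y.
Proof.
  unfold equal_at, equal; rewrite chi_top; split.
  - intros [u Hu]; rewrite pairing_comp, comp_id_l in Hu.
    now rewrite <- (pr1_pairing (topos_lim E) x y), <- Hu, pr1_pairing,
      <- (pr2_pairing (topos_lim E) x y), <- Hu, pr2_pairing.
  - intros ->; exists y; now rewrite pairing_comp, comp_id_l.
Qed.

Lemma equal_at_comp (V W B : E) (x y : hom W B) (p : hom V W) :
  (x =Ω y) ∘ p = (x ∘ p =Ω y ∘ p).
Proof. unfold equal_at; now rewrite <- comp_assoc, pairing_comp. Qed.

Lemma meet_at_top (W : E) (u v : hom W Ω) :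
  (u ∧ v) = top W <-> u = top W /\ v = top W.
Proof.
  unfold meet_at, meet; rewrite chi_top; split.
  - intros [w Hw]; rewrite pairing_comp, (to_one_eq w (to_one W)) in Hw.
    split.
    + now rewrite <- (pr1_pairing (topos_lim E) u v), <- Hw, pr1_pairing.
    + now rewrite <- (pr2_pairing (topos_lim E) u v), <- Hw, pr2_pairing.
  - intros [-> ->]; exists (to_one W); now rewrite pairing_comp.
Qed.

Lemma meet_at_comp (V W : E) (u v : hom W Ω) (p : hom V W) :
  (u ∧ v) ∘ p = (u ∘ p ∧ v ∘ p).
Proof. unfold meet_at; now rewrite <- comp_assoc, pairing_comp. Qed.

(** Heyting implication, read off the order of Ω: u ≤ v iff u ∧ v = u. *)
Definition imp_at (W : E) (u v : hom W Ω) : hom W Ω := ((u ∧ v) =Ω u).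

Arguments imp_at {W} u v.

Lemma imp_at_comp (V W : E) (u v : hom W Ω) (p : hom V W) :
  imp_at u v ∘ p = imp_at (u ∘ p) (v ∘ p).
Proof. unfold imp_at; now rewrite equal_at_comp, meet_at_comp. Qed.

Lemma imp_at_top (W : E) (u v : hom W Ω) :
  imp_at u v = top W <->
  forall (V : E) (p : hom V W), u ∘ p = top V -> v ∘ p = top V.
Proof.
  unfold imp_at; rewrite equal_at_top; split.
  - intros H V p Hu; rewrite <- H, meet_at_comp, meet_at_top in Hu; apply Hu.
  - intros H; apply omega_ext; intros V p.
    rewrite meet_at_comp, meet_at_top; split; [intuition | split; auto].
Qed.

(** Unfolds the two nested equalizers. A test family [T] is exactly one that lifts to [img_above],
    and [b] lifts to [img_ob] exactly when it belongs to every such family at every later stage. *)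
Lemma img_mor_factor (X Y W : E) (f : hom X Y) (b : hom W Y) :
  (exists u : hom W (img_ob f), img_mor f ∘ u = b) <->
  forall (V : E) (p : hom V W) (T : hom V (𝒫 Y)),
    (forall (V' : E) (q : hom V' V) (x : hom V' X),
      (f ∘ x ∈ T ∘ q) = top V') ->
    (b ∘ p ∈ T) = top V.
Proof.
  split.
  - intros [u <-] V p T HT.
    assert (Habove : img_inv f ∘ T = img_full X Y ∘ T).
    { apply pow_ext_forced; intros V' q x; rewrite <- !comp_assoc.
      unfold img_inv, img_full; rewrite !mem_at_transpose, top_comp, mem_at_comp.
      rewrite <- comp_assoc, pr1_pairing, pr2_pairing, HT; tauto. }
    destruct (eqz_univ (topos_lim E) Habove) as [t [Ht _]].
    change (img_above_mor f ∘ t = T) in Ht.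
    transitivity (t ∈ img_rel f ∘ (img_mor f ∘ (u ∘ p))).
    { unfold img_rel; rewrite mem_at_transpose, mem_at_comp.
      now rewrite <- !comp_assoc, pr1_pairing, pr2_pairing, Ht. }
    rewrite comp_assoc; unfold img_mor, img_ob; rewrite eqz_eq.
    rewrite <- comp_assoc; unfold img_all; now rewrite mem_at_transpose, top_comp.
  - intros H.
    (* The test is applied to the families [img_above_mor f ∘ t], which contain every [f ∘ x] by
       construction. *)
    assert (Hb : img_rel f ∘ b = img_all f ∘ b).
    { apply pow_ext_forced; intros V p t; rewrite <- !comp_assoc.
      unfold img_rel, img_all; rewrite !mem_at_transpose, top_comp, mem_at_comp.
      rewrite <- comp_assoc, pr1_pairing, pr2_pairing, H; [tauto|].
      intros V' q x; rewrite <- comp_assoc; apply img_above_mem. }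
    destruct (eqz_univ (topos_lim E) Hb) as [u [Hu _]]; now exists u.
Qed.

(** The image in question is that of U_A → B × PA. Generalized elements of U_A are the pairs ⟨x, u⟩
    with x ∈ u, so a test over U_A becomes a test over such pairs. *)
Lemma mem_direct_image (A B W : E) (f : hom A B) (b : hom W B)
    (s : hom W (𝒫 A)) :
  (b ∈ direct_image f ∘ s) = top W <->
  forall (V : E) (p : hom V W) (T : hom V (𝒫 (B × 𝒫 A))),
    (forall (V' : E) (q : hom V' V) (x : hom V' A) (u : hom V' (𝒫 A)),
      (x ∈ u) = top V' -> (⟨ f ∘ x, u ⟩ ∈ T ∘ q) = top V') ->
    (⟨ b ∘ p, s ∘ p ⟩ ∈ T) = top V.
Proof.
  unfold direct_image; rewrite mem_at_transpose, chi_top.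
  etransitivity; [apply img_mor_factor|].
  set (m := sub_mor (mem (topos_pow E) A)).
  assert (Hm : forall (V : E) (x : hom V A) (u : hom V (𝒫 A)),
    (x ∈ u) = top V -> exists w, m ∘ w = ⟨ x, u ⟩).
  { intros V x u Hxu.
    destruct (sub_classified (mem (topos_pow E) A)) as [_ Hpb].
    destruct (Hpb V ⟨ x, u ⟩ (to_one V) Hxu) as [w [[Hw _] _]]; now exists w. }
  assert (Hmem : forall (V : E) (w : hom V (sub_ob (mem (topos_pow E) A))),
    (π₁ ∘ (m ∘ w) ∈ π₂ ∘ (m ∘ w)) = top V).
  { intros V w; unfold mem_at; rewrite <- pairing_unique, comp_assoc.
    apply top_along; exact (proj1 (sub_classified (mem (topos_pow E) A))). }
  split; intros H V p T HT; [rewrite <- pairing_comp | rewrite pairing_comp];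
    apply H.
  - intros V' q w.
    rewrite <- comp_assoc, pairing_comp, <- comp_assoc; apply HT, Hmem.
  - intros V' q x u Hxu; destruct (Hm V' x u Hxu) as [w Hw].
    specialize (HT V' q w).
    now rewrite <- comp_assoc, Hw, pairing_comp, <- comp_assoc,
      pr1_pairing, pr2_pairing in HT.
Qed.

Lemma forces_exists_var (Z Y W : E) (psi : hom (Z × Y) Ω) (a : hom W Z) :
  forces (exists_var psi) a <->
  (to_one W ∈ direct_image (to_one Y) ∘ (transpose (psi ∘ ⟨ π₂, π₁ ⟩) ∘ a))
    = top W.
Proof.
  unfold forces, exists_var, pow_one.
  rewrite <- comp_assoc, mem_at_comp, comp_id_l, <- comp_assoc.
  rewrite (to_one_eq (to_one (𝒫 𝟙) ∘ _) (to_one W)); tauto.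
Qed.

Section FibreMeet.

Variables (A B : E) (f : hom A B).

(** Kept with the swap ⟨π₂, π₁⟩ so that it is literally the transpose occurring inside [exists_var]
    for the formula of the theorem, and [fold] recognizes it. *)
Definition fibre_meet : hom (B × 𝒫 A) (𝒫 A) :=
  transpose (((π₁ ∘ π₁ =Ω f ∘ π₂) ∧ (@pr2 _ (topos_lim E) (B × 𝒫 A) A ∈ π₂ ∘ π₁))
    ∘ ⟨ π₂, π₁ ⟩).

Lemma mem_fibre_meet (W : E) (y : hom W A) (b : hom W B) (u : hom W (𝒫 A)) :
  (y ∈ fibre_meet ∘ ⟨ b, u ⟩) = top W <-> b = f ∘ y /\ (y ∈ u) = top W.
Proof.
  unfold fibre_meet; rewrite mem_at_transpose, <- comp_assoc, pairing_comp.
  rewrite pr1_pairing, pr2_pairing, meet_at_comp, meet_at_top.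
  rewrite equal_at_comp, equal_at_top, mem_at_comp, <- !comp_assoc.
  repeat (rewrite pr1_pairing || rewrite pr2_pairing); tauto.
Qed.

End FibreMeet.

End GeneralizedElements.

Arguments imp_at {E W} u v.
Arguments fibre_meet {E A B} f.

Theorem proposition3p9 (E : topos) (A B : E) (f : hom A B)
    (W : E) (a : hom W B) (s : hom W (pow (topos_pow E) A)) :
  forces (mem (topos_pow E) B) (⟨ a, direct_image f ∘ s ⟩)%topos
  <->
  forces
    (let b : hom ((B × 𝒫 A) × A) B := π₁ ∘ π₁ in
     let t : hom ((B × 𝒫 A) × A) (𝒫 A) := π₂ ∘ π₁ in
     let y : hom ((B × 𝒫 A) × A) A := π₂ in
     exists_var ((b =Ω f ∘ y) ∧ (y ∈ t)))%topos
    (⟨ a, s ⟩)%topos.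
Proof.
  cbv zeta; rewrite forces_exists_var; fold (fibre_meet f).
  change (forces (mem (topos_pow E) B) ⟨ a, direct_image f ∘ s ⟩)
    with ((a ∈ direct_image f ∘ s) = top W).
  rewrite !mem_direct_image.
  split; intros H V p T HT.
  - set (T' := transpose
      (⟨ to_one _, fibre_meet f ∘ @pr1 _ (topos_lim E) (B × 𝒫 A) V ⟩
        ∈ T ∘ π₂)).
    assert (HT' : forall (V' : E) (q : hom V' V) (b : hom V' B)
        (u : hom V' (𝒫 A)),
      (⟨ b, u ⟩ ∈ T' ∘ q)
      = (⟨ to_one V', fibre_meet f ∘ ⟨ b, u ⟩ ⟩ ∈ T ∘ q)).
    { intros V' q b u; unfold T'.
      rewrite mem_at_transpose, mem_at_comp, pairing_comp, <- !comp_assoc.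
      rewrite pr1_pairing, pr2_pairing.
      now rewrite (to_one_eq (to_one _ ∘ _) (to_one V')). }
    specialize (H V p T').
    (* [HT'] speaks of [T' ∘ q]; the inserted identity serves as [q]. *)
    rewrite <- (comp_id_r T'), HT', !comp_id_r in H.
    rewrite (to_one_eq _ (to_one V)), <- comp_assoc, pairing_comp; apply H.
    intros V' q x u Hxu; rewrite HT', <- (to_one_eq (to_one A ∘ x) (to_one V')).
    (* Here [x] itself inhabits the set attached to ⟨f x, u⟩: f x = f x is trivial and x ∈ u is
       given. *)
    now apply HT, mem_fibre_meet.
  - set (D := fibre_meet f ∘ ⟨ a ∘ p, s ∘ p ⟩).
    set (tau := ⟨ a ∘ p, s ∘ p ⟩ ∈ T).
    set (T' := transpose (imp_at
      (π₂ ∘ @pr1 _ (topos_lim E) (𝟙 × 𝒫 A) V =Ω D ∘ π₂) (tau ∘ π₂))).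
    assert (HT' : forall (V' : E) (q : hom V' V) (c : hom V' 𝟙)
        (v : hom V' (𝒫 A)),
      (⟨ c, v ⟩ ∈ T' ∘ q) = imp_at (v =Ω D ∘ q) (tau ∘ q)).
    { intros V' q c v; unfold T'.
      rewrite mem_at_transpose, imp_at_comp, equal_at_comp, <- !comp_assoc.
      now rewrite pr1_pairing, !pr2_pairing. }
    specialize (H V p T').
    rewrite <- (comp_id_r T'), HT', imp_at_top in H.
    assert (Htau : tau ∘ idm V ∘ idm V = top V).
    { apply H.
      - intros V' q x v Hxv; rewrite comp_id_r, HT'; apply imp_at_top.
        (* Once v = D, the element x of v lies in D, whence a = f x and x ∈ s; the hypothesis on [T]
           at the pair ⟨x, s⟩ then yields [tau]. *)
        intros V'' r Hv; rewrite equal_at_comp in Hv.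
        apply (proj1 (equal_at_top _ _ _ _ _)) in Hv.
        assert (Hx : (x ∘ r ∈ v ∘ r) = top V'')
          by (rewrite <- mem_at_comp; now apply top_along).
        rewrite Hv in Hx; unfold D in Hx.
        rewrite <- !comp_assoc, pairing_comp in Hx.
        apply (proj1 (mem_fibre_meet _ _ _ _ _ _ _ _)) in Hx; destruct Hx as [Ha Hs].
        unfold tau; rewrite <- comp_assoc, mem_at_comp, pairing_comp, Ha.
        now apply HT.
      (* Modus ponens at the identity stage: the tested set is [D] itself, so the antecedent v = D
         holds. *)
      - apply top_along; apply equal_at_top.
        now rewrite <- comp_assoc, pairing_comp, comp_id_r. }
    now rewrite !comp_id_r in Htau.
Qed.
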